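(* Let $m\ge7$ be odd, $h=\frac{m-1}{2}$, $f_5(x)=x^{2^{2h}-2^h+1}\in\mathbb{F}_{2^m}[x]$, and let $s^\infty$ be the sequence $s_t=\operatorname{Tr}(f_5(\alpha^t+1))$, $t\ge0$. Let $L_s=1+m(2^{(m-1)/2}-1)$ if $m\equiv1\pmod4$ and $L_s=1+m(2^{(m-1)/2}-3)$ if $m\equiv3\pmod4$. Then the binary cyclic code $\mathcal{C}_s$ has parameters $[2^m-1,\,2^m-1-L_s,\,d(\mathcal{C}_s)]$ with $2^{(m-3)/2}\le d(\mathcal{C}_s)\le L_s$.
   Context: Let $v=2^m-1$, $\alpha$ a primitive element of $\mathbb{F}_{2^m}$, and $\operatorname{Tr}(x)=\sum_{i=0}^{m-1}x^{2^i}$ the absolute trace from $\mathbb{F}_{2^m}$ to $\mathbb{F}_2$. For a polynomial $F$ over $\mathbb{F}_{2^m}$ the binary sequence $s^\infty=(s_t)_{t\ge0}$ is defined by $s_t=\operatorname{Tr}(F(\alpha^t+1))$; it is periodic with period dividing $v$. Its minimal polynomial $g_s(x)$ is the polynomial $1+c_1x+\dots+c_Lx^L\in\mathbb{F}_2[x]$ of least degree $L$ such that $s_i+c_1s_{i-1}+\dots+c_Ls_{i-L}=0$ for all $i\ge L$; its degree $L_s$ is the linear span of $s^\infty$. $\mathcal{C}_s$ denotes the binary cyclic code of length $v$ with generator polynomial $g_s(x)$. $d(\mathcal{C})$ denotes minimum Hamming distance. *)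

(* Defs.v *)
From HB Require Import structures.
From mathcomp Require Import all_boot all_order all_algebra all_field.
Set Implicit Arguments. Unset Strict Implicit. Unset Printing Implicit Defensive.
Import GRing.Theory.
Local Open Scope ring_scope.

Definition trace2 (F : finFieldType) (m : nat) (x : F) : F :=
  \sum_(i < m) x ^+ (2 ^ i).

(* element of F (assumed in {0,1}, i.e. the prime field) read as a bit *)
Definition to_bit (F : finFieldType) (x : F) : 'F_2 := if x == 0 then 0 else 1.

Definition lfsr_poly (s : nat -> 'F_2) (g : {poly 'F_2}) : Prop :=
  g`_0 = 1 /\
  forall i : nat, ((size g).-1 <= i)%N ->
    \sum_(j < size g) g`_j * s (i - j)%N = 0.

Definition is_minpoly_seq (s : nat -> 'F_2) (g : {poly 'F_2}) : Prop :=
  lfsr_poly s g /\ forall g', lfsr_poly s g' -> (size g <= size g')%N.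

Definition poly_rV (v : nat) (p : {poly 'F_2}) : 'rV['F_2]_v :=
  \row_(i < v) p`_i.

(* binary cyclic code of length v generated by g: the ideal (g) in
   F_2[x]/(x^v - 1), i.e. the span of the x^i g mod (x^v - 1) *)
Definition cyclic_code (v : nat) (g : {poly 'F_2}) : {vspace 'rV['F_2]_v} :=
  <<[seq poly_rV v (('X^i * g) %% ('X^v - 1)) | i <- iota 0 v]>>%VS.

Definition hweight (v : nat) (c : 'rV['F_2]_v) : nat :=
  #|[set i : 'I_v | c 0 i != 0]|.

(* minimum distance: least weight of a nonzero codeword (v if the code is 0) *)
Definition min_dist (v : nat) (C : {vspace 'rV['F_2]_v}) : nat :=
  \big[minn/v]_(c : 'rV['F_2]_v | (c \in C) && (c != 0)) hweight c.

(* Main.v *)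
Require Import Defs.
From HB Require Import structures.
From mathcomp Require Import all_boot all_order all_algebra all_field.
From mathcomp Require Import zify ring.
Set Implicit Arguments.
Unset Strict Implicit.
Unset Printing Implicit Defensive.
Import GRing.Theory.
Local Open Scope ring_scope.

(* With m = 2h+1 and x = alpha^t, conjugating the exponent by 2^(h+1) and using
   (x+1)^(2^h-1) = 1 + x + ... + x^(2^h-1) in characteristic 2 gives
     s_t = \sum_(j < 2^h) (Tr(x^j) + Tr(x^(j + 2^(h+1)))).
   Since Tr(x^(2j)) = Tr(x^j), repeatedly halving even exponents cancels terms
   in pairs and leaves 1 plus a sum of Tr(x^r) over an explicit set of odd
   r < 3 * 2^h, distinct from 2^h+1 and 2^(h+1)+1 (whose traces coincide and
   cancel).  Such r lie in pairwise distinct 2-cyclotomic cosets of full size m,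
   so s_t is a sum of t-th powers of Ls distinct elements z, and the minimal
   polynomial is the product of the X - z^-1.  Its roots include those of
   exponents -(2^(h+1)+3+2j), 0 <= j < 2^(h-1)-1, an arithmetic progression to
   which the BCH bound applies.  It vanishes at 1 and has even degree Ls, so it
   cannot have all Ls+1 coefficients equal to 1; this gives the upper bound. *)

(** Vandermonde argument: the functional sending [P] to the sum of [a i * P.[z i]] kills all
    polynomials of degree below [size r], and the product of the ['X - z w] over the other indices
    [w] isolates [a i0]. *)
Lemma power_sums_eq0 (F : fieldType) (I : eqType) (r : seq I) (z a : I -> F) :
  uniq (map z r) ->
  (forall j, (j < size r)%N -> \sum_(i <- r) a i * z i ^+ j = 0) ->
  forall i, i \in r -> a i = 0.
Proof.
move=> uz sum0 i0 ri0.
have ur := map_uniq uz.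
pose P := \prod_(w <- rem i0 r) ('X - (z w)%:P).
have szP : (size P <= size r)%N.
  rewrite /P size_prod_XsubC size_rem // prednK //.
  by case: (r) ri0.
have : \sum_(i <- r) a i * P.[z i] = 0.
  under eq_bigr => i _ do rewrite (horner_coef_wide _ szP) mulr_sumr.
  rewrite exchange_big big1 // => j _.
  under eq_bigr => i _ do rewrite mulrCA.
  by rewrite -mulr_sumr sum0 ?mulr0.
rewrite (big_rem i0) //= [X in _ + X]big_seq big1 ?addr0; last first.
  move=> i ri; suff /rootP -> : root P (z i) by rewrite mulr0.
  by rewrite /P -(big_map z predT (fun u => 'X - u%:P)) root_prod_XsubC map_f.
move/eqP; rewrite mulf_eq0 => /orP[/eqP //|/eqP/rootP].
rewrite /P -(big_map z predT (fun u => 'X - u%:P)) root_prod_XsubC => /mapP[i].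
move=> ri zE; have := uz.
rewrite (perm_uniq (perm_map z (perm_to_rem ri0))) /= => /andP[/negP[]].
by rewrite zE map_f.
Qed.

(** * The 2-cyclotomic cosets modulo 2^(2h+1) - 1 and their leaders *)

Lemma digit_lt a b x y : (a < x -> b < y -> a + b * x < y * x)%N.
Proof.
move=> ax xy; apply: leq_trans (_ : b.+1 * x <= _)%N => //.
  by rewrite mulSn ltn_add2r.
by rewrite leq_mul2r xy orbT.
Qed.

(** With m = 2h+1, multiplication by 2^i rotates m-bit words: r = A 2^(m-i) + B goes to A + B 2^i.
    If 0 < i, oddness of r' and r makes A and B odd, the upper bounds leave only i = h or i = h+1
    with A = B = 1, and then r' or r is 2^h + 1. *)
Lemma cyclotomic_coset_rigid h r r' i :
    odd r -> odd r' -> (r < 3 * 2 ^ h)%N -> (r' < 3 * 2 ^ h)%N ->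
    r != (2 ^ h).+1 -> r' != (2 ^ h).+1 -> (i < h.*2.+1)%N -> (2 <= h)%N ->
  (r * 2 ^ i = r' %[mod 2 ^ h.*2.+1 - 1])%N -> i = 0%N.
Proof.
move=> or or' ltr ltr' nr nr' lti h2.
have e2 : (2 ^ h.*2.+1 = 2 * 2 ^ h * 2 ^ h)%N by rewrite expnS -addnn expnD mulnA.
have h4 : (4 <= 2 ^ h)%N by rewrite -[4%N]/(2 ^ 2)%N leq_exp2l.
case: (posnP i) => // i0.
set v := (2 ^ _ - 1)%N.
have v0 : (3 * 2 ^ h <= v)%N by rewrite /v e2; nia.
have em : (2 ^ h.*2.+1 = 2 ^ (h.*2.+1 - i) * 2 ^ i)%N by rewrite -expnD subnK // ltnW.
set A := (r %/ 2 ^ (h.*2.+1 - i))%N; set B := (r %% 2 ^ (h.*2.+1 - i))%N.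
have rE : r = (A * 2 ^ (h.*2.+1 - i) + B)%N by exact: divn_eq.
have ltB : (B < 2 ^ (h.*2.+1 - i))%N by rewrite ltn_mod expn_gt0.
have ltA : (A < 2 ^ i)%N by rewrite ltn_divLR ?expn_gt0 // mulnC -em; lia.
have -> : (r * 2 ^ i = A * v + (A + B * 2 ^ i))%N.
  rewrite {1}rE mulnDl -mulnA -em /v mulnBr muln1; have := leq_pmulr A (expn_gt0 2 h.*2.+1); lia.
rewrite modnMDl => eqr.
have leAB : (A + B * 2 ^ i <= v)%N by rewrite /v -ltnS subn1 prednK ?expn_gt0 // em digit_lt.
have {eqr} r'E : r' = (A + B * 2 ^ i)%N.
  move: eqr; rewrite [RHS]modn_small; last lia.
  (* The all-ones word is the only rotation not already reduced; it would give r' = 0, which is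
     even. *)
  move: leAB; rewrite leq_eqVlt => /orP[/eqP ->|lt]; last by rewrite modn_small.
  by rewrite modnn => r0; move: or'; rewrite -r0.
have oA : odd A by move: or'; rewrite r'E oddD oddM oddX; case: (i) i0 => //= k _; rewrite andbF addbF.
have oB : odd B.
  move: or; rewrite rE oddD oddM oddX; have : (0 < h.*2.+1 - i)%N by lia.
  by case: (_ - i)%N => //= k _; rewrite andbF.
have A0 : (0 < A)%N by case: (A) oA.
have B0 : (0 < B)%N by case: (B) oB.
have key k : (2 ^ k < 3 * 2 ^ h)%N -> (k <= h.+1)%N.
  move=> lt; rewrite leqNgt; apply/negP => hk.
  have : (2 ^ h.+2 <= 2 ^ k)%N by rewrite leq_exp2l.
  by rewrite !expnS; lia.
have i1 : (i <= h.+1)%N.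
  by apply: key; apply: leq_ltn_trans ltr'; rewrite r'E (leq_trans (leq_pmull _ B0)) ?leq_addl.
have i2 : (h.*2.+1 - i <= h.+1)%N.
  by apply: key; apply: leq_ltn_trans ltr; rewrite rE (leq_trans (leq_pmull _ A0)) ?leq_addr.
have odd1 n : odd n -> (n < 3)%N -> n = 1%N by case: n => [|[|[]]].
have [iE|iE] : i = h \/ i = h.+1 by lia.
  have mi : (h.*2.+1 - i = h.+1)%N by lia.
  move: rE r'E; rewrite mi iE expnS => rE r'E.
  have A1 : A = 1%N.
    apply: odd1 => //; rewrite -(ltn_pmul2r (expn_gt0 2 h)); apply: leq_ltn_trans ltr.
    by rewrite rE; lia.
  have B1 : B = 1%N.
    apply: odd1 => //; rewrite -(ltn_pmul2r (expn_gt0 2 h)); apply: leq_ltn_trans ltr'.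
    by rewrite r'E; lia.
  by move: nr'; rewrite r'E A1 B1 mul1n eqxx.
have mi : (h.*2.+1 - i = h)%N by lia.
move: rE r'E; rewrite mi iE expnS => rE r'E.
have A1 : A = 1%N.
  apply: odd1 => //; rewrite -(ltn_pmul2r (expn_gt0 2 h)); apply: leq_ltn_trans ltr.
  by rewrite rE; lia.
have B1 : B = 1%N.
  apply: odd1 => //; rewrite -(ltn_pmul2r (expn_gt0 2 h)); apply: leq_ltn_trans ltr'.
  by rewrite r'E; lia.
by move: nr; rewrite rE A1 B1 mul1n addn1 eqxx.
Qed.

(* An index j stands for the odd exponent 2j+1; [leaders h] lists, one per
   2-cyclotomic coset modulo 2^(2h+1) - 1, the cosets left after cancellation
   modulo 2.  The values of [low_leaders] below 2 are irrelevant. *)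
Fixpoint low_leaders h : seq nat :=
  if h is (h'.+2 as k).+2 then
    iota (3 * 2 ^ h'.+1) (2 ^ h'.+1) ++ iota (2 ^ h'.+1) (2 ^ h') ++
    low_leaders k
  else if h == 3%N then [:: 3%N] else [:: 0%N; 1%N].

Definition leaders h : seq nat :=
  iota (2 ^ h).+1 (2 ^ h.-1).-1 ++ iota (2 ^ h.-1).+1 (2 ^ h.-2).-1 ++
  low_leaders h.

Lemma size_low_leaders h : (2 <= h)%N ->
  ((size (low_leaders h)).+1 = 2 ^ h.-2 + (~~ odd h).*2)%N.
Proof.
elim/ltn_ind: h => -[|[|[|[|h]]]] // IH _.
rewrite /= !size_cat !size_iota.
have /= := IH h.+2 (leqnSn _) isT.
by rewrite !negbK !expnS; case: (odd h) => /=; lia.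
Qed.

Lemma size_leaders h : (3 <= h)%N ->
  (size (leaders h) = 2 ^ h - if odd h then 3 else 1)%N.
Proof.
move=> h3; rewrite !size_cat !size_iota.
have := size_low_leaders (ltnW h3).
case: h h3 => [|[|[|h]]] //= _.
have := expn_gt0 2 h.
by rewrite !negbK !expnS; case: (odd h) => /=; lia.
Qed.

Lemma low_leaders_bound h j : (2 <= h)%N -> j \in low_leaders h -> (j < 2 ^ h.-1)%N.
Proof.
elim/ltn_ind: h => -[|[|[|[|h]]]] // IH _.
- by rewrite !inE => /orP[] /eqP ->.
- by rewrite !inE => /eqP ->.
rewrite /= !mem_cat !mem_iota => /or3P[||/(IH h.+2 (leqnSn _) isT)] /=;
  rewrite !expnS; lia.
Qed.

Lemma low_leaders_uniq h : (2 <= h)%N -> uniq (low_leaders h).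
Proof.
elim/ltn_ind: h => -[|[|[|[|h]]]] // IH _.
rewrite /= !cat_uniq !iota_uniq (IH h.+2) //= !andbT; apply/andP; split; apply/hasPn => j.
  rewrite mem_cat mem_iota => /orP[|/(@low_leaders_bound h.+2 _ isT)] /=;
  rewrite mem_iota !expnS; lia.
by move=> /(@low_leaders_bound h.+2 _ isT) /=; rewrite mem_iota !expnS; lia.
Qed.

Lemma leaders_uniq h : (2 <= h)%N -> uniq (leaders h).
Proof.
move=> h2; rewrite /leaders !cat_uniq !iota_uniq low_leaders_uniq //= andbT.
have lb := @low_leaders_bound h _ h2.
apply/andP; split; apply/hasPn => j; last first.
  by move=> /lb; rewrite mem_iota; lia.
rewrite mem_cat mem_iota mem_iota => /orP[|/lb];
  case: h h2 {lb} => [|[|h]] //= _; rewrite !expnS; lia.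
Qed.

(** These are the conditions that [cyclotomic_coset_rigid] puts on an odd exponent. *)
Lemma leaders_bound h j : (2 <= h)%N -> j \in leaders h ->
  (j.*2.+1 < 3 * 2 ^ h)%N && (j.*2.+1 != (2 ^ h).+1).
Proof.
move=> h2; rewrite !mem_cat !mem_iota.
have lb := @low_leaders_bound h j h2.
move=> /or3P[||/lb]; case: h h2 {lb} => [|[|h]] //= _; rewrite !expnS; lia.
Qed.

(** * Cancellation in sums whose terms are invariant under doubling the index *)

Section SumOverLeaders.
Variables (V : comPzRingType) (T : nat -> V).
Hypotheses (addVV : forall x : V, x + x = 0) (T2 : forall j, T j.*2 = T j).

(** [ring] does not use [addVV]; naming the part [z] that occurs twice leaves an identity valid in
    any commutative ring. *)
Let cancel2 (x y z : V) : x = y + (z + z) -> x = y.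
Proof. by rewrite addVV addr0. Qed.

Let P h := \sum_(1 <= j < 2 ^ h) T j.
Let U h := \sum_(0 <= j < 2 ^ h) T (j + 2 ^ h.+1)%N.
Let D a b := \sum_(j <- iota a b) T j.*2.+1.

Let even_odd (G : nat -> V) n : \sum_(0 <= j < n.*2) G j =
  \sum_(0 <= j < n) G j.*2.+1 + \sum_(0 <= j < n) G j.*2.
Proof.
elim: n => [|n IH]; first by rewrite !big_geq ?addr0.
by rewrite doubleS !big_nat_recr //= IH; ring.
Qed.

Let U_rec h : U h.+1 = D (2 ^ h.+1) (2 ^ h) + U h.
Proof.
have -> : U h.+1 = \sum_(0 <= j < (2 ^ h).*2) T (j + 2 ^ h.+2)%N.
  by rewrite /U [X in index_iota _ X]expnS mul2n.
rewrite even_odd; congr (_ + _).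
  rewrite /D -[in iota _ _](addn0 (2 ^ h.+1)%N) iotaDl big_map /index_iota subn0.
  by apply: eq_bigr => j _; congr T; rewrite !expnS; lia.
by apply: eq_bigr => j _; rewrite -(T2 (j + _)); congr T; rewrite !expnS; lia.
Qed.

Let P_rec h : P h.+1 = D 0 (2 ^ h) + P h.
Proof.
have E k : P k = \sum_(0 <= j < 2 ^ k) T j - T 0%N.
  by rewrite [in RHS]big_ltn ?expn_gt0 // addrC addKr.
rewrite !E expnS mul2n even_odd /D /index_iota subn0 -addrA; congr (_ + (_ - _)).
by apply: eq_bigr => j _; rewrite T2.
Qed.

Let D_cat a b c : D a (b + c) = D a b + D (a + b) c.
Proof. by rewrite /D iotaD big_cat. Qed.

(** For h >= 4, applying both recursions twice returns the same pair of sums at h-2. Among the odd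
    exponents split off, the indices in [0, 2^(h-2)) and [2^(h-2), 3 * 2^(h-3)) occur twice and
    cancel; the rest are the two intervals prepended by [low_leaders]. *)
Let sum_low_leaders h : (2 <= h)%N ->
  P h + U h.-2 = \sum_(j <- low_leaders h) T j.*2.+1.
Proof.
elim/ltn_ind: h => -[|[|[|[|h]]]] // IH _.
- rewrite /P /U /= /index_iota /= !big_cons !big_nil.
  have t2 := T2 1%N; rewrite /= in t2.
  rewrite /= !add0n -[(2 ^ 1)%N]/2%N t2.
  by apply: (@cancel2 _ _ (T 1%N)); ring.
- rewrite /P /U /= /index_iota /= !big_cons !big_nil.
  have t2 := T2 1%N; have t4 := T2 2%N; have t6 := T2 3%N; rewrite /= in t2 t4 t6.
  rewrite -[(1 + 2 ^ 2)%N]/5%N -[(0 + 2 ^ 2)%N]/4%N /= t6 t4 t2.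
  by apply: (@cancel2 _ _ (T 1%N + T 1%N + T 3%N + T 5%N)); ring.
rewrite [low_leaders _]/= !big_cat /= -(IH h.+2) //=.
rewrite -/(D _ _) -/(D _ _) 2!U_rec 2!P_rec.
have -> : D 0 (2 ^ h.+3) =
    D 0 (2 ^ h.+2) + (D (2 ^ h.+2) (2 ^ h.+1) + D (3 * 2 ^ h.+1) (2 ^ h.+1)).
  have -> : (3 * 2 ^ h.+1 = 2 ^ h.+2 + 2 ^ h.+1)%N by rewrite !expnS; lia.
  rewrite -D_cat -[X in D X (2 ^ h.+1 + _)]add0n -D_cat; congr (D 0 _).
  by rewrite !expnS; lia.
by apply: (@cancel2 _ _ (D 0 (2 ^ h.+2) + D (2 ^ h.+2) (2 ^ h.+1))); ring.
Qed.

(** Two halvings bring the second sum to the form of [sum_low_leaders] and split off two intervals,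
    whose first exponents are 2^(h+1) + 1 and 2^h + 1. Their terms agree by hypothesis and cancel,
    which is why [leaders] starts each interval one index later. *)
Lemma sum_leaders h : (2 <= h)%N -> T (2 ^ h).+1 = T (2 ^ h.+1).+1 ->
  \sum_(1 <= j < 2 ^ h) T j + \sum_(0 <= j < 2 ^ h) T (j + 2 ^ h.+1)%N =
  \sum_(j <- leaders h) T j.*2.+1.
Proof.
move=> h2 Th; rewrite -/(P h) -/(U h) !big_cat /= -sum_low_leaders // -/(D _ _) -/(D _ _).
case: h h2 Th => [|[|h]] //= _ Th; rewrite 2!U_rec.
have E a b : (0 < b)%N -> D a b = T a.*2.+1 + D a.+1 b.-1.
  by case: b => // b _; rewrite /D /= big_cons.
rewrite !(E (2 ^ _)%N) ?expn_gt0 // -!mul2n -!expnS Th.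
by apply: (@cancel2 _ _ (T (2 ^ h.+3).+1)); ring.
Qed.
End SumOverLeaders.

(** * The absolute trace in characteristic 2 and the spectrum of the sequence *)

Section AbsoluteTrace.
Variables (F : finFieldType) (m : nat).
Hypotheses (cardF : #|F| = (2 ^ m)%N) (char2 : 2%N \in [pchar F]).

Lemma expf_2m (y : F) : y ^+ (2 ^ m) = y.
Proof. by rewrite -cardF expf_card. Qed.

Lemma expDn_2X (x y : F) k : (x + y) ^+ (2 ^ k) = x ^+ (2 ^ k) + y ^+ (2 ^ k).
Proof. by rewrite exprDn_pchar // pnatX (pnatE _ (pcharf_prime char2)) char2. Qed.

Lemma trace2D (x y : F) : trace2 m (x + y) = trace2 m x + trace2 m y.
Proof. by rewrite -big_split; apply: eq_bigr => i _; rewrite /= expDn_2X. Qed.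

Lemma trace2_sum (I : Type) (r : seq I) (G : I -> F) :
  trace2 m (\sum_(i <- r) G i) = \sum_(i <- r) trace2 m (G i).
Proof.
elim: r => [|i r IH]; last by rewrite !big_cons trace2D IH.
by rewrite !big_nil /trace2 big1 // => i _; rewrite expr0n expn_eq0.
Qed.

Lemma trace2_sqr (y : F) : trace2 m (y ^+ 2) = trace2 m y.
Proof.
case: m (expf_2m y) => [|n] yE; first by rewrite /trace2 !big_ord0.
rewrite /trace2 [LHS]big_ord_recr [RHS]big_ord_recl /= -exprM -expnS yE.
by rewrite addrC expn0 expr1; congr (_ + _); apply: eq_bigr => i _; rewrite -exprM -expnS.
Qed.

Lemma trace2_2X (y : F) k : trace2 m (y ^+ (2 ^ k)) = trace2 m y.
Proof.
by elim: k => [|k IH]; rewrite ?expr1 // expnSr exprM trace2_sqr.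
Qed.

Lemma trace2_idem (y : F) : trace2 m y ^+ 2 = trace2 m y.
Proof.
rewrite -[RHS]trace2_sqr /trace2.
have -> : (\sum_(i < m) y ^+ (2 ^ i)) ^+ 2 = \sum_(i < m) (y ^+ (2 ^ i)) ^+ 2.
  elim: (m) => [|n IH]; first by rewrite !big_ord0 expr0n.
  by rewrite !big_ord_recr /= (expDn_2X _ _ 1) IH.
by apply: eq_bigr => i _; rewrite -!exprM mulnC.
Qed.

Lemma trace2_1 : odd m -> trace2 m (1 : F) = 1.
Proof.
move=> om; rewrite /trace2; under eq_bigr do rewrite expr1n.
rewrite sumr_const card_ord -(odd_double_half m) om -muln2 mulrnDr mulrnA.
by rewrite -[_ *+ 2]mulr_natr (pcharf0 char2) mulr0 addr0.
Qed.

(** Since 2^(h+1) - 1 = (2^h - 1) + 2^h, each step adds a factor x^(2^h) + 1, which doubles the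
    range of exponents. *)
Lemma exp1D_Mersenne (x : F) h :
  (x + 1) ^+ (2 ^ h - 1) = \sum_(0 <= j < 2 ^ h) x ^+ j.
Proof.
elim: h => [|h IH]; first by rewrite subnn big_nat1.
have -> : (2 ^ h.+1 - 1 = (2 ^ h - 1) + 2 ^ h)%N.
  by rewrite expnS; have := expn_gt0 2 h; lia.
rewrite exprD IH expDn_2X expr1n mulrDr mulr1 addrC.
rewrite [RHS](@big_cat_nat _ _ _ (2 ^ h)) ?leq_exp2l //=; congr (_ + _).
rewrite -[in RHS](add0n (2 ^ h)%N) big_addn expnS mul2n -addnn addnK mulr_suml.
by apply: eq_bigr => j _; rewrite exprD.
Qed.

(* Multiplying the exponent by 2^(h+1) turns it, modulo 2^m - 1, into
   (2^h - 1) + 2^(h+1). *)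
Lemma trace2_kasami (x : F) h : m = h.*2.+1 -> (2 <= h)%N ->
  trace2 m ((x + 1) ^+ (2 ^ (2 * h) - 2 ^ h + 1)) =
  1 + \sum_(j <- leaders h) trace2 m (x ^+ j.*2.+1).
Proof.
move=> mE h2.
have e2 : (2 ^ m = 2 ^ h * 2 ^ h.+1)%N by rewrite mE -expnD addnS addnn.
rewrite -(trace2_2X _ h.+1) -exprM.
have -> : ((2 ^ (2 * h) - 2 ^ h + 1) * 2 ^ h.+1 = 2 ^ m * (2 ^ h - 1) + 2 ^ h.+1)%N.
  by rewrite e2 mul2n -addnn expnD !mulnDl !mulnBl !mulnBr mul1n muln1; lia.
rewrite exprD exprM expf_2m exp1D_Mersenne expDn_2X expr1n mulrDr mulr1.
(* The constant term of the unshifted sum contributes Tr(1) = 1, as m is odd. *)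
rewrite addrC trace2D big_ltn ?expn_gt0 // trace2D trace2_1 ?mE /= ?odd_double // -mE.
rewrite -addrA; congr (_ + _).
rewrite -big_ltn ?expn_gt0 // mulr_suml !trace2_sum.
under [X in _ + X]eq_bigr do rewrite -exprD.
apply: (@sum_leaders _ (fun j => trace2 m (x ^+ j))) => //.
- by move=> y; rewrite -mulr2n -mulr_natr (pcharf0 char2) mulr0.
- by move=> j; rewrite -muln2 exprM trace2_sqr.
(* (2^h + 1) 2^(h+1) = 2^m + 2^(h+1), and x^(2^m) = x; hence the traces at 2^h + 1 and 2^(h+1) + 1
   coincide. *)
rewrite -(trace2_2X _ h.+1) -exprM mulSn -e2 exprD expf_2m.
by rewrite exprS mulrC.
Qed.

(* The elements z of F with s_t = \sum_z z ^+ t; their inverses are the roots of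
   the minimal polynomial. *)
Definition spectrum (alpha : F) h : seq F :=
  1 :: [seq alpha ^+ (j.*2.+1 * 2 ^ i) | j <- leaders h, i <- iota 0 m].

Lemma size_spectrum alpha h : size (spectrum alpha h) = (1 + m * size (leaders h))%N.
Proof. by rewrite /= size_allpairs size_iota mulnC. Qed.

Lemma trace2_spectrum alpha h t : m = h.*2.+1 -> (2 <= h)%N ->
  trace2 m ((alpha ^+ t + 1) ^+ (2 ^ (2 * h) - 2 ^ h + 1)) =
  \sum_(z <- spectrum alpha h) z ^+ t.
Proof.
move=> mE h2; rewrite trace2_kasami // big_cons expr1n big_allpairs_dep.
congr (_ + _); apply: eq_bigr => j _.
rewrite /trace2 -(big_mkord predT (fun i => (alpha ^+ t ^+ j.*2.+1) ^+ (2 ^ i))).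
rewrite /index_iota subn0.
by apply: eq_bigr => i _; rewrite -!exprM; congr (_ ^+ _); lia.
Qed.

(** The first interval of [leaders] stands for consecutive odd exponents; their progression of step
    2 feeds the BCH bound. *)
Lemma spectrum_progression alpha h j : m = h.*2.+1 -> (j < 2 ^ h.-1 - 1)%N ->
  alpha ^+ (2 ^ h.+1 + 3 + 2 * j) \in spectrum alpha h.
Proof.
move=> mE jh; rewrite inE; apply/orP; right.
apply/allpairsP; exists ((2 ^ h).+1 + j, 0)%N => /=; split.
- by rewrite mem_cat mem_iota; apply/orP; left; lia.
- by rewrite mem_iota; lia.
by congr (_ ^+ _); rewrite expnS; lia.
Qed.

(** Stability under Frobenius is what puts the coefficients of the minimal polynomial in F_2. *)
Lemma spectrum_sqr alpha h z : z \in spectrum alpha h -> z ^+ 2 \in spectrum alpha h.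
Proof.
rewrite !inE => /orP[/eqP ->|/allpairsP[[j i] /= [rj ri ->]]].
  by rewrite expr1n eqxx.
apply/orP; right; move: ri; rewrite mem_iota add0n => /andP[_ ri].
case: (ltnP i.+1 m) => im.
  apply/allpairsP; exists (j, i.+1) => /=; split=> //; first by rewrite mem_iota.
  by rewrite -exprM -mulnA -expnSr.
have iE : i.+1 = m by lia.
apply/allpairsP; exists (j, 0%N) => /=; split=> //; first by rewrite mem_iota /=; lia.
by rewrite -exprM -mulnA -expnSr iE mulnC exprM expf_2m muln1.
Qed.

Lemma spectrum_expr alpha h z v : alpha ^+ v = 1 -> z \in spectrum alpha h -> z ^+ v = 1.
Proof.
move=> av; rewrite inE => /orP[/eqP ->|/allpairsP[[j i] /= [_ _ ->]]].
  by rewrite expr1n.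
by rewrite -exprM mulnC exprM av expr1n.
Qed.

(** Equal powers of alpha give congruent exponents; [cyclotomic_coset_rigid] equates the conjugation
    indices, and the odd exponents, being below the modulus, are then equal. *)
Lemma spectrum_uniq alpha h : m = h.*2.+1 -> (2 <= h)%N ->
  (2 ^ m - 1)%N.-primitive_root alpha -> uniq (spectrum alpha h).
Proof.
move=> mE h2 pa.
have v0 : (3 * 2 ^ h <= 2 ^ m - 1)%N.
  rewrite mE expnS -addnn expnD.
  have : (2 ^ 2 <= 2 ^ h)%N by rewrite leq_exp2l.
  nia.
(* Raising to the power 2^(m-i') undoes the smaller conjugation, since y^(2^m) = y. *)
have reduce j j' i i' : (i < m)%N -> (i' <= i)%N ->
  alpha ^+ (j.*2.+1 * 2 ^ i) = alpha ^+ (j'.*2.+1 * 2 ^ i') ->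
  alpha ^+ (j.*2.+1 * 2 ^ (i - i')) = alpha ^+ j'.*2.+1.
  move=> im le /(congr1 (fun y => y ^+ (2 ^ (m - i')))).
  rewrite -!exprM -!mulnA -!expnD (_ : i + (m - i') = (i - i') + m)%N; last lia.
  rewrite subnKC; last lia.
  by rewrite expnD mulnA !(exprM _ _ (2 ^ m)) !expf_2m.
have inj j j' i i' : j \in leaders h -> j' \in leaders h ->
  (i < m)%N -> (i' <= i)%N ->
  alpha ^+ (j.*2.+1 * 2 ^ i) = alpha ^+ (j'.*2.+1 * 2 ^ i') -> (j, i) = (j', i').
  move=> /(leaders_bound h2) /andP[lj nj] /(leaders_bound h2) /andP[lj' nj'] im le.
  move=> /(reduce _ _ _ _ im le) /eqP.
  rewrite (eq_prim_root_expr pa) => /eqP E.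
  have di : (i - i' = 0)%N.
    apply: (@cyclotomic_coset_rigid h j.*2.+1 j'.*2.+1); rewrite ?oddS ?odd_double -?mE //.
    lia.
  move: E; rewrite di muln1 !modn_small; [move=> E; congr (_, _); lia|lia|lia].
rewrite /spectrum cons_uniq; apply/andP; split.
  apply/negP => /allpairsP[[j i] /= [rj ri]].
  move=> /(congr1 (fun y => y ^+ (2 ^ (m - i)))).
  move: ri; rewrite mem_iota => /= ri.
  rewrite expr1n -exprM -mulnA -expnD subnKC; last lia.
  rewrite exprM expf_2m => /esym /eqP.
  rewrite -(expr0 alpha) (eq_prim_root_expr pa) mod0n.
  case/andP: (leaders_bound h2 rj) => lj _; rewrite modn_small //; lia.
apply: allpairs_uniq; rewrite ?leaders_uniq ?iota_uniq // => -[j i] [j' i'].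
move=> /allpairsP[[a b] /= [ra rb [-> ->]]] /allpairsP[[a' b'] /= [ra' rb' [-> ->]]] /= E.
move: rb rb'; rewrite !mem_iota /= => rb rb'.
case: (leqP b' b) => le; first by apply: inj.
by apply/esym; apply: inj => //; lia.
Qed.
End AbsoluteTrace.

(** * Binary cyclic codes: membership, dimension and minimum distance *)

Section CyclicCodes.
Variables (v : nat) (g : {poly 'F_2}).
Hypotheses (v0 : (0 < v)%N) (g_dvd : g %| 'X^v - 1).

Let size_Xv1 : size ('X^v - 1 : {poly 'F_2}) = v.+1.
Proof. by rewrite -polyC1 size_XnsubC. Qed.

Let g_neq0 : g != 0.
Proof.
apply: contraTneq g_dvd => ->; rewrite dvd0p -size_poly_eq0.
by rewrite size_Xv1.
Qed.

(** Reduction modulo X^v - 1 preserves divisibility by its divisor g. Conversely, a multiple q g of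
    degree below v combines shifts X^i g with i < [size q], which need no reduction. *)
Lemma mem_cyclic_code (c : 'rV_v) : (c \in cyclic_code v g) = (g %| rVpoly c).
Proof.
have sz_mod (p : {poly 'F_2}) : (size (p %% ('X^v - 1))%R <= v)%N.
  rewrite -ltnS -size_Xv1 ltn_modp -size_poly_gt0.
  by rewrite size_Xv1.
apply/idP/idP => [Cc|/dvdpP[q cE]].
  rewrite (coord_span (X := in_tuple _) Cc) linear_sum /=.
  apply: (big_ind (fun p => g %| p)) => [|p q|i _]; [exact: dvdp0|exact: dvdp_add|].
  rewrite linearZ /= -mul_polyC dvdp_mull //.
  have /mapP[k _ ->] := mem_nth 0 (ltn_ord i).
  by rewrite poly_rV_K ?sz_mod // -(dvdp_mod _ g_dvd) dvdp_mull.
have [q0|q0] := eqVneq q 0.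
  by rewrite -[c]rVpolyK cE q0 mul0r linear0 mem0v.
have szq : (size q + size g <= v.+1)%N.
  have : (size (rVpoly c) <= v)%N by exact: size_poly.
  by rewrite cE size_mul // -ltnS => /(leq_trans (leqSpred _)).
rewrite -[c]rVpolyK cE -[q]coefK poly_def mulr_suml linear_sum /=.
apply: memv_suml => i _; rewrite -scalerAl linearZ memvZ // memv_span //.
apply/mapP; exists (i : nat).
  by rewrite mem_iota /= add0n -ltnS (leq_trans _ szq) // -addn1 leq_add ?ltn_ord ?size_poly_gt0.
rewrite modp_small // size_Xv1 // mulrC size_mulXn //.
by rewrite (leq_trans _ szq) // -addSn leq_add2r ltn_ord.
Qed.

(** Multiplication by g maps the polynomials of degree below v - deg g linearly and bijectively onto
    the code. *)
Lemma dim_cyclic_code : (size g <= v)%N -> \dim (cyclic_code v g) = (v - (size g).-1)%N.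
Proof.
move=> szg; set k := (v - _)%N.
have kE : (k + (size g).-1 = v)%N by rewrite subnK //; lia.
pose f (u : 'rV['F_2]_k) : 'rV['F_2]_v := mxpoly.poly_rV (rVpoly u * g).
have f_lin : linear f by move=> a u w; rewrite /f linearP mulrDl -scalerAl linearP.
pose fM := GRing.isLinear.Build _ _ _ _ f f_lin.
pose fL : {linear _ -> _} := HB.pack f fM.
have sz_f (u : 'rV['F_2]_k) : (size (rVpoly u * g)%R <= v)%N.
  apply: leq_trans (size_polyMleq _ _) _.
  rewrite -subn1 -addnBA ?size_poly_gt0 // subn1 -kE leq_add2r.
  exact: size_poly.
have -> : cyclic_code v g = limg (linfun fL).
  apply/vspaceP => c; rewrite mem_cyclic_code; apply/idP/memv_imgP => [|[u _ ->]].
    move/dvdpP => [q cE]; exists (mxpoly.poly_rV q); first exact: memvf.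
    rewrite lfunE /= /f poly_rV_K -?cE ?rVpolyK //.
    case: (eqVneq q 0) => [->|q0]; first by rewrite size_poly0.
    have : (size (rVpoly c) <= v)%N by exact: size_poly.
    by rewrite cE size_mul // -subn1 -addnBA ?size_poly_gt0 // subn1 -kE leq_add2r.
  by rewrite lfunE /= /f poly_rV_K ?sz_f // dvdp_mull.
suff /eqP ker0 : lker (linfun fL) == 0%VS.
  by rewrite limg_dim_eq ?ker0 ?capv0 // dimvf; exact: mul1n.
apply/lker0P => u w; rewrite !lfunE /= /f => /(congr1 rVpoly).
rewrite !poly_rV_K ?sz_f // => /(mulIf g_neq0) /(congr1 (@mxpoly.poly_rV _ k)).
by rewrite !rVpolyK.
Qed.
End CyclicCodes.

(** The condition d <= v accounts for the value v from which the minimum in [min_dist] starts. *)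
Lemma leq_min_dist v (C : {vspace 'rV['F_2]_v}) d : (d <= v)%N ->
  (forall c, c \in C -> c != 0 -> (d <= hweight c)%N) -> (d <= min_dist C)%N.
Proof.
move=> dv dC; rewrite /min_dist; elim/big_ind: _ => // [x y dx dy|c /andP[]].
  by rewrite leq_min dx.
exact: dC.
Qed.

Lemma min_dist_leq v (C : {vspace 'rV['F_2]_v}) c :
  c \in C -> c != 0 -> (min_dist C <= hweight c)%N.
Proof.
move=> Cc c0; rewrite /min_dist.
elim: (index_enum _) (mem_index_enum c) => // a r IH; rewrite inE big_cons.
case/predU1P => [<-|/IH le]; first by rewrite Cc c0 geq_minl.
by case: ifP => // _; exact: leq_trans (geq_minr _ _) le.
Qed.

Lemma F2_neq0 (x : 'F_2) : x != 0 -> x = 1.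
Proof. by case: x => -[|[|n]] //= lt _; apply: val_inj. Qed.

(** If all coefficients of g were 1, g(1) would be the parity of [size g], namely 1. So g, itself a
    codeword, has a zero among its [size g] coefficients. *)
Lemma min_dist_even v (g : {poly 'F_2}) :
  (0 < v)%N -> g %| 'X^v - 1 -> (size g <= v)%N -> g.[1] = 0 -> odd (size g) ->
  (min_dist (cyclic_code v g) <= (size g).-1)%N.
Proof.
move=> v0 gdvd szg g1 og.
have g0 : g != 0 by rewrite -size_poly_gt0; case: (size g) og.
have [i /eqP gi] : exists i : 'I_(size g), g`_i == 0.
  apply/existsP; apply: contraT; rewrite negb_exists => /forallP gn.
  move: g1; rewrite horner_coef.
  under eq_bigr => i _ do rewrite expr1n mulr1 (F2_neq0 (gn i)).
  rewrite sumr_const card_ord -[size g]odd_double_half og -muln2 mulrnDr mulrnA.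
  by rewrite -[_ *+ 2]mulr_natr (pcharf0 (pchar_Fp _)) // mulr0 addr0 => /eqP; rewrite oner_eq0.
pose c : 'rV['F_2]_v := mxpoly.poly_rV g.
have cg : rVpoly c = g by rewrite poly_rV_K.
apply: leq_trans (@min_dist_leq _ _ c _ _) _; first by rewrite mem_cyclic_code ?cg.
  by apply: contraNneq g0 => c0; rewrite -cg c0 linear0.
rewrite /hweight.
have -> : (size g).-1 = #|[set~ i]| by rewrite cardsC1 card_ord.
have w_inj : injective (widen_ord szg).
  by move=> x y E; apply: val_inj; exact: (congr1 val E).
rewrite -(card_imset _ w_inj) subset_leq_card //.
apply/subsetP => k; rewrite inE mxE => gk.
have ks : (k < size g)%N by rewrite ltnNge; apply: contraNN gk => /(nth_default 0) ->.
apply/imsetP; exists (Ordinal ks); last exact: val_inj.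
by rewrite !inE; apply: contraNneq gk => E; apply/eqP; rewrite -[RHS]gi -E.
Qed.

(** For a codeword c with support S of size at most d, the roots b q^j say that the weights c_k b^k
    on the distinct nodes q^k, k in S, have vanishing power sums for j < d; [power_sums_eq0] then
    gives c = 0. *)
Lemma BCH_bound (F : fieldType) (emb : {rmorphism 'F_2 -> F}) v (g : {poly 'F_2})
    (b q : F) d :
  (0 < v)%N -> g %| 'X^v - 1 -> b != 0 -> v.-primitive_root q -> (d < v)%N ->
  (forall j, (j < d)%N -> root (map_poly emb g) (b * q ^+ j)) ->
  (d.+1 <= min_dist (cyclic_code v g))%N.
Proof.
move=> v0 gdvd b0 qv dv roots; apply: leq_min_dist => // c; rewrite mem_cyclic_code // => gc c0.
rewrite ltnNge; apply: contra c0 => wc; apply/eqP/rowP => i; rewrite mxE.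
pose S := [set i : 'I_v | c 0 i != 0].
case: (boolP (i \in S)) => [iS|]; last by rewrite inE negbK => /eqP.
apply: (fmorph_inj emb); rewrite rmorph0; apply/eqP.
suff : emb (c 0 i) * b ^+ i == 0 by rewrite mulf_eq0 expf_eq0 (negPf b0) andbF orbF.
apply/eqP; apply: (@power_sums_eq0 F _ (enum S) (fun i => q ^+ i)
  (fun i => emb (c 0 i) * b ^+ i)); last by rewrite mem_enum.
  rewrite map_inj_in_uniq ?enum_uniq // => k l _ _ /eqP.
  by rewrite (eq_prim_root_expr qv) !modn_small // => /eqP /val_inj.
move=> j; rewrite -cardE => jd.
have /rootP : root (map_poly emb (rVpoly c)) (b * q ^+ j).
  have := roots _ (leq_trans jd wc); rewrite -!dvdp_XsubCl => /dvdp_trans; apply.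
  by rewrite dvdp_map.
rewrite (@horner_coef_wide _ v); last by rewrite size_map_poly size_poly.
rewrite big_enum /= => E; rewrite -[RHS]E [RHS](bigID (mem S)) /= [X in _ + X]big1 ?addr0.
  apply: eq_bigr => k _; rewrite coef_map /= coef_rVpoly_ord exprMn -exprM mulnC exprM.
  by rewrite mulrA.
move=> k; rewrite inE negbK => /eqP ck.
by rewrite coef_map /= coef_rVpoly_ord ck rmorph0 mul0r.
Qed.

(** * The minimal polynomial of a sequence of power sums *)

Section MinimalPolynomial.
Variables (F : finFieldType) (emb : {rmorphism 'F_2 -> F}).

Lemma to_bitK (x : F) : x ^+ 2 = x -> emb (to_bit x) = x.
Proof.
rewrite /to_bit => x2; case: eqVneq => [->|x0]; first by rewrite rmorph0.
by apply: (mulfI x0); rewrite rmorph1 mulr1 -expr2 x2.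
Qed.

Variables (Z : seq F) (s : nat -> 'F_2).
Hypotheses (uniqZ : uniq Z) (Z0 : 0 \notin Z).
Hypothesis sE : forall t, emb (s t) = \sum_(z <- Z) z ^+ t.

(** Inverses appear because a feedback polynomial 1 + c_1 x + ... is the reciprocal of the
    characteristic polynomial of the recurrence. *)
Let M := \prod_(z <- Z) ('X - (z^-1)%:P).

Let root_M x : root M x = (x \in map GRing.inv Z).
Proof.
by rewrite /M -(big_map GRing.inv predT (fun u => 'X - u%:P)) root_prod_XsubC.
Qed.

Let neq0 z : z \in Z -> z != 0.
Proof. by apply: contraTneq => ->. Qed.

Lemma dvd_prod_XsubVP (p : {poly F}) :
  reflect (forall z, z \in Z -> root p z^-1) (M %| p).
Proof.
apply: (iffP idP) => [Mp z Zz|Zp].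
  rewrite -dvdp_XsubCl; apply: dvdp_trans Mp.
  by rewrite dvdp_XsubCl root_M map_f.
rewrite /M -(big_map GRing.inv predT (fun u => 'X - u%:P)); apply: uniq_roots_dvdp.
  by apply/allP => _ /mapP[z Zz ->]; exact: Zp.
by rewrite uniq_rootsE map_inj_uniq //; exact: invr_inj.
Qed.

Let recurrenceE (g : {poly 'F_2}) i : ((size g).-1 <= i)%N ->
  emb (\sum_(j < size g) g`_j * s (i - j)%N) =
  \sum_(z <- Z) (map_poly emb g).[z^-1] * z ^+ i.
Proof.
move=> ig; rewrite rmorph_sum.
have E z : z \in Z ->
  (map_poly emb g).[z^-1] * z ^+ i = \sum_(j < size g) emb g`_j * z ^+ (i - j).
  move=> Zz; rewrite horner_coef size_map_poly mulr_suml; apply: eq_bigr => j _.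
  rewrite coef_map -mulrA; congr (_ * _).
  (* The truncated subtraction i - j is a true one here, so z^(i-j) = z^(-j) z^i. *)
  have ji : (j <= i)%N by apply: leq_trans ig; rewrite -ltnS (leq_trans (ltn_ord j)) ?leqSpred.
  by rewrite -{1}(subnK ji) exprD exprVn mulrC mulfK ?expf_neq0 ?neq0.
rewrite [RHS]big_seq (eq_bigr _ E) -big_seq exchange_big /=.
by apply: eq_bigr => j _; rewrite rmorphM sE mulr_sumr.
Qed.

(** With n = deg g, the recurrence from n on says that the weights g(1/z) z^n have vanishing power
    sums over Z, so every g(1/z) is 0. *)
Lemma lfsr_polyE g : lfsr_poly s g <-> g`_0 = 1 /\ M %| map_poly emb g.
Proof.
split=> -[g0 H]; split=> //.
  apply/dvd_prod_XsubVP => z Zz; apply/rootP.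
  have : (map_poly emb g).[z^-1] * z ^+ (size g).-1 = 0.
    apply: (@power_sums_eq0 _ _ Z id (fun z => (map_poly emb g).[z^-1] * z ^+ (size g).-1)) => //.
      by rewrite map_id.
    move=> j _; rewrite -[RHS](rmorph0 emb) -(H ((size g).-1 + j)%N) ?leq_addr //.
    rewrite recurrenceE ?leq_addr //; apply: eq_bigr => w _.
    by rewrite exprD mulrA.
  by move/eqP; rewrite mulf_eq0 expf_eq0 (negPf (neq0 Zz)) andbF orbF => /eqP.
move=> i gi; apply: (fmorph_inj emb); rewrite recurrenceE // rmorph0 big_seq big1 // => z Zz.
by move/dvd_prod_XsubVP: H => /(_ z Zz) /rootP ->; rewrite mul0r.
Qed.

Hypothesis Zsqr : forall z, z \in Z -> z ^+ 2 \in Z.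

(** Squaring is injective and maps Z into itself, so it permutes Z and fixes M. Each coefficient
    thus equals its square and descends through [to_bit]; the constant one is nonzero because 0 is
    not a root. *)
Let M_F2 : exists2 g, map_poly emb g = M & g`_0 = 1.
Proof.
have char2 : 2%N \in [pchar F] by rewrite (fmorph_pchar emb) pchar_Fp.
have FrobM : map_poly (pFrobenius_aut char2) M = M.
  rewrite map_prod_XsubC.
  under eq_bigr do rewrite /= pFrobenius_autE exprVn.
  rewrite -(big_map (fun z => z ^+ 2) predT (fun z => 'X - (z^-1)%:P)); apply: perm_big.
  have uniqZ2 : uniq [seq z ^+ 2 | z <- Z].
    by rewrite map_inj_uniq // => x y; rewrite -!(pFrobenius_autE char2) => /fmorph_inj.
  have sub : {subset [seq z ^+ 2 | z <- Z] <= Z} by move=> _ /mapP[z Zz ->]; exact: Zsqr.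
  apply: uniq_perm => //.
  by have [] := uniq_min_size uniqZ2 sub; rewrite ?size_map.
have coefM i : M`_i ^+ 2 = M`_i by rewrite -{2}FrobM coef_map /= pFrobenius_autE.
have mapM : map_poly emb (map_poly (@to_bit F) M) = M.
  apply/polyP => i; rewrite coef_map coef_map_id0 /to_bit ?eqxx //.
  exact: to_bitK.
exists (map_poly (@to_bit F) M) => //.
rewrite coef_map_id0 /to_bit ?eqxx //; case: eqP => // /eqP M0.
move: M0; rewrite -horner_coef0 -/(root M 0) root_M => /mapP[z Zz] /esym /eqP.
by rewrite invr_eq0 (negPf (neq0 Zz)).
Qed.

Lemma minpoly_seq_exists : exists g, is_minpoly_seq s g.
Proof.
have [g gM g0] := M_F2; exists g; split=> [|g' /lfsr_polyE[g'0 Mg']].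
  by apply/lfsr_polyE; rewrite gM dvdpp.
rewrite -(size_map_poly emb) gM -(size_map_poly emb g') dvdp_leq //.
by rewrite map_poly_eq0; apply: contra_eq_neq g'0 => ->; rewrite coef0 eq_sym oner_eq0.
Qed.

Lemma minpoly_seq_eqp g : is_minpoly_seq s g -> M %= map_poly emb g.
Proof.
move=> [/lfsr_polyE[g0 Mg] gmin]; rewrite -dvdp_size_eqp // eqn_leq dvdp_leq //=.
  have [g' gM g'0] := M_F2.
  rewrite size_map_poly -gM size_map_poly gmin //.
  by apply/lfsr_polyE; rewrite gM dvdpp.
by rewrite map_poly_eq0; apply: contra_eq_neq g0 => ->; rewrite coef0 eq_sym oner_eq0.
Qed.
End MinimalPolynomial.

Theorem theorem5 (F : finFieldType) (m : nat) (alpha : F) :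
  #|F| = (2 ^ m)%N -> 2%N \in [pchar F] ->
  (7 <= m)%N -> odd m ->
  (2 ^ m - 1)%N.-primitive_root alpha ->
  let v := (2 ^ m - 1)%N in
  let h := ((m - 1) %/ 2)%N in
  let f5 := fun x : F => x ^+ (2 ^ (2 * h) - 2 ^ h + 1)%N in
  let s := fun t : nat => to_bit (trace2 m (f5 (alpha ^+ t + 1))) in
  let Ls := if (m %% 4 == 1)%N then (1 + m * (2 ^ ((m - 1) %/ 2) - 1))%N
            else (1 + m * (2 ^ ((m - 1) %/ 2) - 3))%N in
  (exists g, is_minpoly_seq s g) /\
  forall g : {poly 'F_2}, is_minpoly_seq s g ->
    (size g).-1 = Ls /\
    \dim (cyclic_code v g) = (v - Ls)%N /\
    (2 ^ ((m - 3) %/ 2) <= min_dist (cyclic_code v g))%N /\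
    (min_dist (cyclic_code v g) <= Ls)%N.
Proof.
move=> cardF char2 m7 om pa v h f5 s Ls.
have mE : m = h.*2.+1 by rewrite /h; lia.
have h3 : (3 <= h)%N by lia.
have h2 := ltnW h3.
have emb : {rmorphism 'F_2 -> F}.
  exact: (GRing.in_alg (pPrimeCharType char2) : {rmorphism _ -> _}).
pose Z := spectrum m alpha h.
have v0 : (0 < v)%N := prim_order_gt0 pa.
have av : alpha ^+ v = 1 := prim_expr_order pa.
have a0 : alpha != 0.
  apply: contraPneq av => ->; rewrite expr0n gtn_eqF // => /esym/eqP.
  by rewrite oner_eq0.
have e8 : (8 <= 2 ^ h)%N by rewrite -[8%N]/(2 ^ 3)%N leq_exp2l.
have vE : v = (2 * (2 ^ h * 2 ^ h) - 1)%N by rewrite /v {1}mE expnS -addnn expnD.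
have hh : (2 ^ h = 2 * 2 ^ h.-1)%N by rewrite -expnS prednK //; lia.
have hv : (2 ^ h <= v)%N.
  have : (8 * 2 ^ h <= 2 ^ h * 2 ^ h)%N by rewrite leq_mul2r e8 orbT.
  lia.
have dE : (2 ^ ((m - 3) %/ 2) = (2 ^ h.-1 - 1).+1)%N.
  by rewrite -subSn ?expn_gt0 // subSS subn0; congr (2 ^ _)%N; lia.
have dv : (2 ^ h.-1 - 1 < v)%N by lia.
have v2 : (2 <= v)%N by lia.
(* As v is odd, this makes alpha^(-2) = alpha^(v-2) primitive, as the BCH bound requires of the
   ratio. *)
have cop : coprime (v - 2) v.
  have ov : odd v by rewrite oddB ?expn_gt0 // oddX; lia.
  suff : coprime (v - 2) (v - 2 + 2) by rewrite subnK.
  by rewrite /coprime gcdnDl -/(coprime _ 2) coprimen2 oddB // ov.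
have qE : (alpha ^+ 2)^-1 = alpha ^+ (v - 2).
  by apply: (mulfI (expf_neq0 2 a0)); rewrite divff ?expf_neq0 // -exprD subnKC ?av //.
have sE t : emb (s t) = \sum_(z <- Z) z ^+ t.
  by rewrite to_bitK ?trace2_idem // /f5 trace2_spectrum.
have uZ : uniq Z by exact: spectrum_uniq.
have Z0 : 0 \notin Z.
  apply/negP => /(spectrum_expr av) /eqP.
  by rewrite expr0n gtn_eqF // eq_sym oner_eq0.
have Zsqr z : z \in Z -> z ^+ 2 \in Z by exact: spectrum_sqr.
have sZ : size Z = Ls.
  rewrite size_spectrum size_leaders // /Ls -/h.
  have -> : (m %% 4 == 1)%N = ~~ odd h by lia.
  by case: (odd h).
have ltLs : (Ls < v)%N.
  have lt2X n : (3 <= n)%N -> (n.*2.+1 <= 2 ^ n)%N.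
    elim: n => // n IH; rewrite leq_eqVlt => /predU1P[<- //|n3].
    by have := IH n3; rewrite expnS; lia.
  (* Hence m 2^h <= 2^(2h) = (v+1)/2, which leaves ample room for Ls < v. *)
  have mh : (m <= 2 ^ h)%N by rewrite {1}mE lt2X.
  have : (m * 2 ^ h <= 2 ^ h * 2 ^ h)%N by rewrite leq_mul2r mh orbT.
  have : (8 * 2 ^ h <= 2 ^ h * 2 ^ h)%N by rewrite leq_mul2r e8 orbT.
  rewrite vE /Ls -/h.
  by case: ifP => _; rewrite mulnBr; lia.
have oLs : ~~ odd Ls.
  have o2 : odd (2 ^ h) = false by rewrite oddX; lia.
  by rewrite /Ls -/h; case: ifP => _; rewrite oddD oddM om oddB ?o2 //; lia.
split; first exact: (minpoly_seq_exists uZ Z0 sE Zsqr).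
move=> g /(minpoly_seq_eqp uZ Z0 sE Zsqr) Mg.
have rootsg z : z \in Z -> root (map_poly emb g) z^-1.
  by apply/dvd_prod_XsubVP => //; move: Mg => /andP[].
have szg : size g = Ls.+1.
  by rewrite -(size_map_poly emb) -(eqp_size Mg) size_prod_XsubC sZ.
have gdvd : g %| 'X^v - 1.
  rewrite -(dvdp_map emb) -(eqp_dvdl _ Mg) rmorphB /= map_polyXn rmorph1.
  apply/dvd_prod_XsubVP => // z Zz; apply/rootP.
  by rewrite !hornerE exprVn (spectrum_expr av Zz) invr1 subrr.
have szgv : (size g <= v)%N by rewrite szg.
split; first by rewrite szg.
split; first by rewrite dim_cyclic_code // szg.
split; last first.
  have -> : Ls = (size g).-1 by rewrite szg.
  apply: min_dist_even => //; last by rewrite szg.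
  apply: (fmorph_inj emb); rewrite -horner_map rmorph1 rmorph0; apply/rootP.
  by rewrite -[1]invr1 rootsg // mem_head.
rewrite dE.
(* The roots are the inverses of the elements in [spectrum_progression], hence the inverted start
   and ratio; there are 2^(h-1) - 1 of them. *)
apply: (@BCH_bound _ emb _ _ (alpha ^+ (2 ^ h.+1 + 3))^-1
  (alpha ^+ 2)^-1) => //.
- by rewrite invr_eq0 expf_neq0.
- by rewrite qE (prim_root_exp_coprime _ pa); exact: cop.
move=> j jd; rewrite exprVn -invfM -exprM -exprD rootsg //.
exact: spectrum_progression.
Qed.
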